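(* Let $X$ be a diagram (strict functor) $X : \mathcal{C} \to \mathcal{U}$ over an admissible inverse category $\mathcal{C}$. Then there exists a Reedy fibrant diagram $Y : \mathcal{C} \to \mathcal{U}$ and an equivalence of diagrams $\eta : X \to Y$.
   Context: We work internally in a two-level type theory: there are fibrant types (with fibrant universe $\mathcal{U}$ and fibrant equality $=$) and strict types (with strict universe $\mathcal{U}^{\mathrm{s}}$ and strict equality $=_{\mathrm{s}}$, satisfying UIP and function extensionality), every fibrant type coercing to a strict type. Categories are strict categories (category laws hold up to strict equality). For a category $\mathcal{C}$ and object $x$, the reduced coslice $x /\!\!/ \mathcal{C}$ is the full subcategory of the coslice $x/\mathcal{C}$ on the non-identity arrows out of $x$; it comes with a forgetful functor $\mathsf{forget} : x /\!\!/ \mathcal{C} \to \mathcal{C}$. A category $\mathcal{C}$ is an inverse category if there is a functor $\varphi : \mathcal{C} \to (\mathbb{N}^{\mathrm{s}})^{\mathrm{op}}$ (where $(\mathbb{N}^{\mathrm{s}})^{\mathrm{op}}(n,m) :\equiv n >^{\mathrm{s}} m$) which creates identities: if $f : \mathcal{C}(x,y)$ and $\varphi_x =_{\mathrm{s}} \varphi_y$, then $x =_{\mathrm{s}} y$ and $f$ is (transported to) the identity. For a functor $X : \mathcal{C} \to \mathcal{U}$ and object $z$, the matching object $M^X_z$ is the (strict, not necessarily fibrant) limit of $x /\!\!/ \mathcal{C} \xrightarrow{\mathsf{forget}} \mathcal{C} \xrightarrow{X} \mathcal{U} \subset \mathcal{U}^{\mathrm{s}}$ (with $z$ in place of $x$).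 A map $p : E \to B$ is a fibration if there is $F : B \to \mathcal{U}$ with each fibre of $p$ over $b$ strictly isomorphic to $F(b)$. $X$ is Reedy fibrant if for all $z$ the canonical map $X_z \to M^X_z$ is a fibration. A functor $X : \mathcal{C} \to \mathcal{U}$ has a fibrant limit if its limit in $\mathcal{U}^{\mathrm{s}}$ is strictly isomorphic to a fibrant type. An inverse category $\mathcal{C}$ is admissible if, for every object $x$, every Reedy fibrant diagram over the reduced coslice $x /\!\!/ \mathcal{C}$ has a fibrant limit. A natural transformation $f : X \to Y$ between diagrams over $\mathcal{C}$ is an equivalence if each component $f_n : X_n \to Y_n$ is an equivalence of types.
   Formalization: In the definition of inverse category, the arrows of (ℕ^s)^op from n to m are taken to be n ≥ m instead of the printed n > m, because with the strict order there are no identity arrows and (ℕ^s)^op would not be a category. *)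

(* Defs.v *)
(* A shallow embedding of two-level type theory: strict types are Rocq types and
   strict equality is [eq], with UIP and function extensionality taken from the
   standard axioms.  Since [eq] is proof-irrelevant it plays the role of a
   strict equality type even though it lives in [Prop].  The fibrant level is
   the structure [TwoLevel].  Existence statements are read as Sigma-types, as
   usual in type theory. *)
From Stdlib Require Import Arith Eqdep Peano_dec FunctionalExtensionality.

Set Implicit Arguments.
Unset Strict Implicit.

(* A type with fibrancy data: an element of the fibrant universe.  The coercion
   [El] is the inclusion of fibrant types into strict types. *)
Record FibType (fib : Type -> Type) : Type := MkFib {
  El :> Type;
  El_fib : fib El
}.

(* Pi, Sigma and the unit type are shared by the two levels.  Fibrant equality
   eliminates into fibrant families only, and its computation rule holds
   strictly.  Nothing more is required (no univalence, no closure of fibrancy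
   under strict isomorphism), so every two-level theory with these type formers
   is an instance. *)
Record TwoLevel : Type := MkTwoLevel {
  fib : Type -> Type;
  fib_unit : fib unit;
  fib_pi : forall (A : Type) (B : A -> Type),
    fib A -> (forall a, fib (B a)) -> fib (forall a, B a);
  fib_sigma : forall (A : Type) (B : A -> Type),
    fib A -> (forall a, fib (B a)) -> fib {a : A & B a};
  Id : forall A : FibType fib, A -> A -> FibType fib;
  Id_refl : forall (A : FibType fib) (a : A), Id a a;
  Id_elim : forall (A : FibType fib) (a : A)
    (P : forall b : A, Id a b -> FibType fib),
    P a (Id_refl a) -> forall (b : A) (p : Id a b), P b p;
  Id_elim_refl : forall (A : FibType fib) (a : A)
    (P : forall b : A, Id a b -> FibType fib) (d : P a (Id_refl a)),
    @Id_elim A a P d a (Id_refl a) = d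
}.

Definition U (T : TwoLevel) : Type := FibType (fib T).

Definition isContr (T : TwoLevel) (A : U T) : Type :=
  {c : A & forall a : A, @Id T A c a}.

Definition hfiber (T : TwoLevel) (A B : U T) (f : A -> B) (b : B) : U T :=
  MkFib (fib_sigma (El_fib A) (fun a : A => El_fib (@Id T B (f a) b))).

Definition isEquiv (T : TwoLevel) (A B : U T) (f : A -> B) : Type :=
  forall b : B, isContr (hfiber f b).

Record StrictIso (A B : Type) : Type := MkStrictIso {
  iso_to : A -> B;
  iso_from : B -> A;
  iso_from_to : forall a, iso_from (iso_to a) = a;
  iso_to_from : forall b, iso_to (iso_from b) = b
}.

Definition fiber (E B : Type) (p : E -> B) (b : B) : Type := {e : E | p e = b}.

Definition isFibration (T : TwoLevel) (E B : Type) (p : E -> B) : Type :=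
  {F : B -> U T & forall b : B, StrictIso (fiber p b) (F b)}.

Record Category : Type := MkCategory {
  Ob :> Type;
  Hom : Ob -> Ob -> Type;
  idm : forall x, Hom x x;
  comp : forall x y z, Hom y z -> Hom x y -> Hom x z;
  comp_idl : forall x y (f : Hom x y), comp (idm y) f = f;
  comp_idr : forall x y (f : Hom x y), comp f (idm x) = f;
  comp_assoc : forall w x y z (h : Hom y z) (g : Hom x y) (f : Hom w x),
    comp h (comp g f) = comp (comp h g) f
}.

Record Functor (C D : Category) : Type := MkFunctor {
  fobj :> C -> D;
  fmap : forall x y, Hom x y -> Hom (fobj x) (fobj y);
  fmap_id : forall x, fmap (idm x) = idm (fobj x);
  fmap_comp : forall x y z (g : Hom y z) (f : Hom x y),
    fmap (comp g f) = comp (fmap g) (fmap f)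
}.

Record NatTrans (C D : Category) (F G : Functor C D) : Type := MkNatTrans {
  component :> forall x : C, Hom (F x) (G x);
  naturality : forall x y (f : Hom x y),
    comp (component y) (fmap F f) = comp (fmap G f) (component x)
}.

Definition compF (C D E : Category) (G : Functor D E) (F : Functor C D) :
  Functor C E.
Proof.
refine (@MkFunctor C E (fun x => G (F x)) (fun x y f => fmap G (fmap F f)) _ _).
- intro x. rewrite fmap_id. apply fmap_id.
- intros x y z g f. rewrite fmap_comp. apply fmap_comp.
Defined.

Definition FullSub (C : Category) (P : C -> Prop) : Category :=
  @MkCategory {x : C | P x}
    (fun x y => Hom (proj1_sig x) (proj1_sig y))
    (fun x => idm (proj1_sig x))
    (fun x y z g f => comp g f)
    (fun x y f => comp_idl f)
    (fun x y f => comp_idr f)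
    (fun w x y z h g f => comp_assoc h g f).

Definition FullSub_incl (C : Category) (P : C -> Prop) :
  Functor (FullSub P) C :=
  @MkFunctor (FullSub P) C (fun x => proj1_sig x) (fun x y f => f)
    (fun x => eq_refl) (fun x y z g f => eq_refl).

Lemma sig_eq_UIP (A B : Type) (k : A -> B) (b : B)
  (u v : {a : A | k a = b}) : proj1_sig u = proj1_sig v -> u = v.
Proof.
destruct u as [u p], v as [v q]; simpl; intro e.
subst v. f_equal. apply UIP.
Qed.

Definition CosOb (C : Category) (x : C) : Type := {y : C & Hom x y}.

Definition CosHom (C : Category) (x : C) (u v : CosOb x) : Type :=
  {h : Hom (projT1 u) (projT1 v) | comp h (projT2 u) = projT2 v}.

Definition coslice_id (C : Category) (x : C) (u : CosOb x) : CosHom u u :=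
  exist _ (idm (projT1 u)) (comp_idl (projT2 u)).

Definition coslice_comp (C : Category) (x : C) (u v w : CosOb x)
  (k : CosHom v w) (h : CosHom u v) : CosHom u w.
Proof.
exists (comp (proj1_sig k) (proj1_sig h)).
rewrite <- comp_assoc, (proj2_sig h). exact (proj2_sig k).
Defined.

Definition Coslice (C : Category) (x : C) : Category.
Proof.
refine (@MkCategory (CosOb x) (@CosHom C x) (@coslice_id C x)
          (@coslice_comp C x) _ _ _).
- intros u v f. apply sig_eq_UIP. apply comp_idl.
- intros u v f. apply sig_eq_UIP. apply comp_idr.
- intros t u v w h g f. apply sig_eq_UIP. apply comp_assoc.
Defined.

Definition Coslice_proj (C : Category) (x : C) : Functor (Coslice x) C :=
  @MkFunctor (Coslice x) C (fun u => projT1 u) (fun u v h => proj1_sig h)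
    (fun u => eq_refl) (fun u v w k h => eq_refl).

Definition RedCoslice (C : Category) (x : C) : Category :=
  FullSub (fun u : Coslice x => u <> existT (fun y => Hom x y) x (idm x)).

Definition forget (C : Category) (x : C) : Functor (RedCoslice x) C :=
  compF (Coslice_proj x) (FullSub_incl _).

(* [Hom n m] is [n >= m]: the non-strict order is needed for identities. *)
Definition NatOp : Category :=
  @MkCategory nat (fun n m => n >= m)
    (fun n => le_n n)
    (fun n m k (g : m >= k) (f : n >= m) => Nat.le_trans k m n g f)
    (fun n m f => le_unique m n _ _)
    (fun n m f => le_unique m n _ _)
    (fun n m k l h g f => le_unique l n _ _).

Definition createsIdentities (C : Category) (phi : Functor C NatOp) : Prop :=
  forall (x y : C) (f : Hom x y), phi x = phi y ->
  exists p : x = y, eq_rect x (fun w => Hom w y) f y p = idm y.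

Definition InverseCategory (C : Category) : Type :=
  {phi : Functor C NatOp | createsIdentities phi}.

Definition StrictTypes : Category :=
  @MkCategory Type (fun A B => A -> B)
    (fun A a => a) (fun A B D g f a => g (f a))
    (fun A B f => eq_refl) (fun A B f => eq_refl)
    (fun A B D E h g f => eq_refl).

Definition FibTypes (T : TwoLevel) : Category :=
  @MkCategory (U T) (fun A B => A -> B)
    (fun A a => a) (fun A B D g f a => g (f a))
    (fun A B f => eq_refl) (fun A B f => eq_refl)
    (fun A B D E h g f => eq_refl).

Definition FibIncl (T : TwoLevel) : Functor (FibTypes T) StrictTypes :=
  @MkFunctor (FibTypes T) StrictTypes (fun A => El A) (fun A B f => f)
    (fun A => eq_refl) (fun A B D g f => eq_refl).

Definition Diagram (T : TwoLevel) (C : Category) : Type :=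
  Functor C (FibTypes T).

Definition isCompatible (D : Category) (F : Functor D StrictTypes)
  (s : forall d : D, F d) : Prop :=
  forall (d e : D) (f : Hom d e), fmap F f (s d) = s e.

Definition Lim (D : Category) (F : Functor D StrictTypes) : Type :=
  {s : forall d : D, F d | isCompatible s}.

Lemma Lim_universal (D : Category) (F : Functor D StrictTypes) (A : Type)
  (c : forall d : D, A -> F d)
  (cP : forall (d e : D) (f : Hom d e) (a : A), fmap F f (c d a) = c e a) :
  exists! u : A -> Lim F, forall d a, proj1_sig (u a) d = c d a.
Proof.
exists (fun a => exist (@isCompatible D F) (fun d => c d a)
                   (fun d e f => cP d e f a)).
split; [reflexivity|].
intros v vP. extensionality a.
assert (vPa : forall d, proj1_sig (v a) d = c d a) by (intro d; apply vP).
destruct (v a) as [s sP]. simpl in vPa.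
assert (e : (fun d => c d a) = s) by (extensionality d; symmetry; apply vPa).
subst s. f_equal.
extensionality d. extensionality e. extensionality f. apply UIP.
Qed.

Definition hasFibrantLimit (T : TwoLevel) (D : Category) (X : Diagram T D) :
  Type :=
  {L : U T & StrictIso (Lim (compF (FibIncl T) X)) L}.

Definition Matching (T : TwoLevel) (C : Category) (X : Diagram T C) (z : C) :
  Type :=
  Lim (compF (FibIncl T) (compF X (forget z))).

Definition matchingMap (T : TwoLevel) (C : Category) (X : Diagram T C) (z : C)
  (a : X z) : Matching X z.
Proof.
exists (fun u => fmap X (projT2 (proj1_sig u)) a).
intros u v h.
change (comp (fmap X (proj1_sig h)) (fmap X (projT2 (proj1_sig u))) a
        = fmap X (projT2 (proj1_sig v)) a).
rewrite <- fmap_comp.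
exact (f_equal (fun g => fmap X g a) (proj2_sig h)).
Defined.

Definition ReedyFibrant (T : TwoLevel) (C : Category) (X : Diagram T C) :
  Type :=
  forall z : C, isFibration T (@matchingMap T C X z).

Definition Admissible (T : TwoLevel) (C : Category) : Type :=
  forall (x : C) (Z : Diagram T (RedCoslice x)),
    ReedyFibrant Z -> hasFibrantLimit Z.

Definition isDiagramEquiv (T : TwoLevel) (C : Category) (X Y : Diagram T C)
  (f : NatTrans X Y) : Type :=
  forall n : C, @isEquiv T (X n) (Y n) (f n).

(* Main.v *)
(** Start from [X] itself and, for [n = 0, 1, ...], replace the values at the
    objects of rank [n]: once the diagram [Y] is Reedy fibrant below rank [n],
    so is its restriction to [z // C] for [z] of rank [n], because the matching
    objects over [z // C] are matching objects over [C]; admissibility then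
    gives a fibrant limit [L], and [Y z] is replaced by the mapping path space
    of [Y z -> L].  Every stage is a diagram on all of [C], and the map from
    one stage to the next is a strict isomorphism away from rank [n], so the
    values at [z] stabilise from stage [S (rank z)] on. *)
From Stdlib Require Import Arith Lia Eqdep FunctionalExtensionality.
Require Import Defs.

Set Implicit Arguments.
Unset Strict Implicit.

(** * Strict limits, strict isomorphisms and fibrations *)

Lemma fmap_id_app (T : TwoLevel) (C : Category) (X : Diagram T C) (x : C)
  (a : X x) : fmap X (idm x) a = a.
Proof. exact (f_equal (fun k => k a) (fmap_id X x)). Qed.

Lemma fmap_comp_app (T : TwoLevel) (C : Category) (X : Diagram T C) (x y z : C)
  (g : Hom y z) (f : Hom x y) (a : X x) :
  fmap X (comp g f) a = fmap X g (fmap X f a).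
Proof. exact (f_equal (fun k => k a) (fmap_comp X g f)). Qed.

Lemma naturality_app (T : TwoLevel) (C : Category) (X Y : Diagram T C)
  (t : NatTrans X Y) (x y : C) (f : Hom x y) (a : X x) :
  t y (fmap X f a) = fmap Y f (t x a).
Proof. exact (f_equal (fun k => k a) (naturality t f)). Qed.

Lemma Lim_eq (D : Category) (F : Functor D StrictTypes) (s t : Lim F) :
  (forall d, proj1_sig s d = proj1_sig t d) -> s = t.
Proof.
destruct s as [s sP], t as [t tP]; simpl; intro e.
assert (e' : s = t) by (extensionality d; apply e). subst t. f_equal.
extensionality d. extensionality d'. extensionality f. apply UIP.
Qed.

Lemma neq_irrelevance (A : Type) (x y : A) (p q : x <> y) : p = q.
Proof. extensionality e. destruct (p e). Qed.

Definition isIso (A B : Type) (f : A -> B) : Type :=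
  {g : B -> A | (forall a, g (f a) = a) /\ (forall b, f (g b) = b)}.

Definition isIso_id (A : Type) : isIso (fun a : A => a) :=
  exist _ (fun a => a) (conj (fun _ => eq_refl) (fun _ => eq_refl)).

Definition isIso_comp (A B D : Type) (g : B -> D) (f : A -> B)
  (ig : isIso g) (jf : isIso f) : isIso (fun a => g (f a)).
Proof.
destruct ig as [g' [g1 g2]], jf as [f' [f1 f2]].
exists (fun d => f' (g' d)). split.
- intro a. rewrite g1. apply f1.
- intro d. rewrite f2. apply g2.
Defined.

Definition isIso_sym (A B : Type) (f : A -> B) (i : isIso f) :
  isIso (proj1_sig i) :=
  exist _ f (conj (proj2 (proj2_sig i)) (proj1 (proj2_sig i))).

Lemma isIso_inj (A B : Type) (f : A -> B) (i : isIso f) (a a' : A) :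
  f a = f a' -> a = a'.
Proof.
destruct i as [g [g1 g2]]. intro e. rewrite <- (g1 a), <- (g1 a'), e.
reflexivity.
Qed.

(** Fibrancy is not assumed stable under strict isomorphism, but being a fibration is: the family
    over [B] is pulled back along [b], and corresponding fibres are strictly isomorphic. *)
Definition isFibration_square (T : TwoLevel) (E B E' B' : Type)
  (p : E -> B) (p' : E' -> B') (a : E' -> E) (b : B' -> B)
  (sq : forall e, b (p' e) = p (a e)) (ia : isIso a) (ib : isIso b) :
  isFibration T p -> isFibration T p'.
Proof.
intros [F FP]. exists (fun x => F (b x)). intro x.
destruct (FP (b x)) as [to from ft tf]. destruct ia as [a' [a1 a2]].
assert (k1 : forall e, p' e = x -> p (a e) = b x).
{ intros e h. rewrite <- sq, h. reflexivity. }
assert (k2 : forall e, p e = b x -> p' (a' e) = x).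
{ intros e h. apply (isIso_inj ib). rewrite sq, a2. exact h. }
refine (@MkStrictIso _ _
  (fun u => to (exist (fun e => p e = b x) (a (proj1_sig u)) (k1 _ (proj2_sig u))))
  (fun v => exist (fun e => p' e = x) (a' (proj1_sig (from v))) (k2 _ (proj2_sig (from v))))
  _ _).
- intro u. apply sig_eq_UIP. simpl. rewrite ft. apply a1.
- intro v. refine (eq_trans _ (tf v)). f_equal. apply sig_eq_UIP. simpl. apply a2.
Defined.

(** * Fibrant equivalences and factorization through a mapping path space *)

Definition ap_Id (T : TwoLevel) (A B : U T) (f : A -> B) (x y : A)
  (p : @Id T A x y) : @Id T B (f x) (f y) :=
  @Id_elim T A x (fun b _ => @Id T B (f x) (f b)) (@Id_refl T B (f x)) y p.

Definition isContr_retract (T : TwoLevel) (A B : U T) (f : A -> B) (g : B -> A)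
  (fg : forall b, f (g b) = b) (c : isContr A) : isContr B.
Proof.
destruct c as [c k]. exists (f c). intro b.
exact (eq_rect _ (fun b' => @Id T B (f c) b') (ap_Id f (k (g b))) _ (fg b)).
Defined.

(** Each homotopy fibre of the composite is a strict retract of the corresponding one of [i],
    through [s] and its inverse on the first component. *)
Definition isEquiv_precomp_iso (T : TwoLevel) (A0 A B : U T) (i : A -> B)
  (s : A0 -> A) (is : isIso s) (e : isEquiv i) : isEquiv (fun a => i (s a)).
Proof.
intro b. destruct is as [s' [s1 s2]].
refine (@isContr_retract T (hfiber i b) (hfiber (fun a => i (s a)) b)
  (fun u => existT (fun a => El (@Id T B (i (s a)) b)) (s' (projT1 u))
     (eq_rect_r (fun a => El (@Id T B (i a) b)) (projT2 u) (s2 (projT1 u))))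
  (fun u => existT (fun a => El (@Id T B (i a) b)) (s (projT1 u)) (projT2 u))
  _ (e b)).
(* With its proof generalized, the strict equality becomes a loop after rewriting, and UIP removes
   the transport. *)
intros [a r]. simpl. generalize (s2 (s a)). rewrite (s1 a).
intro h. rewrite (UIP_refl _ _ h). reflexivity.
Defined.

(* A strict retraction whose homotopy is strictly reflexivity on the image:
   these computation rules replace the half-adjoint correction. *)
Definition isEquiv_strict_retract (T : TwoLevel) (A B : U T) (i : A -> B)
  (r : B -> A) (ri : forall a, r (i a) = a)
  (H : forall b, @Id T B (i (r b)) b)
  (Hi : forall a, eq_rect _ (fun a' => El (@Id T B (i a') (i a))) (H (i a)) _ (ri a)
                  = @Id_refl T B (i a)) :
  isEquiv i.
Proof.
intro b.
exists (existT (fun a => El (@Id T B (i a) b)) (r b) (H b)).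
intros [a p].
refine (@Id_elim T B (i a) (fun b' p' => @Id T (hfiber i b')
  (existT (fun a => El (@Id T B (i a) b')) (r b') (H b'))
  (existT (fun a => El (@Id T B (i a) b')) a p')) _ b p).
assert (e : existT (fun a' => El (@Id T B (i a') (i a))) (r (i a)) (H (i a))
            = existT (fun a' => El (@Id T B (i a') (i a))) a (@Id_refl T B (i a))).
{ rewrite <- Hi. destruct (ri a). reflexivity. }
rewrite e. apply Id_refl.
Defined.

(** [M] is only a strict type because it will be a matching object, which need not itself be
    fibrant. *)
Record Factorization (T : TwoLevel) (A : U T) (M : Type) (f : A -> M) :=
  MkFactorization {
  mid : U T;
  mid_in : A -> mid;
  mid_out : mid -> M;
  mid_out_in : forall a, mid_out (mid_in a) = f a;
  mid_in_equiv : isEquiv mid_in;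
  mid_out_fib : isFibration T mid_out
}.

(** The mapping path space is formed over the fibrant copy [L], and its projection is then read back
    in [M] through the isomorphism. *)
Definition factorize (T : TwoLevel) (A : U T) (M : Type) (L : U T)
  (s : StrictIso M L) (f : A -> M) : Factorization f.
Proof.
destruct s as [to from ft tf].
set (g := fun a => to (f a)).
set (N := MkFib (fib_sigma (El_fib L) (fun m => El_fib (hfiber g m))) : U T).
set (i := (fun a => existT _ (g a) (existT _ a (@Id_refl T L (g a)))) : A -> N).
refine (@MkFactorization T A M f N i (fun w => from (projT1 w)) _ _ _).
- intro a. apply ft.
(* Path induction on [q] contracts each point onto the image of [i]; by [Id_elim_refl] this homotopy
   is strictly reflexivity on that image. *)
- set (H := fun w : N => match w return @Id T N (i (projT1 (projT2 w))) w with
    | existT _ m (existT _ a q) =>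
      @Id_elim T L (g a)
        (fun m' q' => @Id T N (i a) (existT _ m' (existT _ a q')))
        (@Id_refl T N (i a)) m q
    end).
  apply (@isEquiv_strict_retract T A N i (fun w => projT1 (projT2 w))
           (fun a => eq_refl) H).
  intro a. simpl.
  exact (Id_elim_refl (P := fun m' q' => @Id T N (i a) (existT _ m' (existT _ a q')))
          (@Id_refl T N (i a))).
- exists (fun m => hfiber g (to m)). intro m.
  assert (k : forall w : N, from (projT1 w) = m -> projT1 w = to m).
  { intros w h. rewrite <- h, tf. reflexivity. }
  refine (@MkStrictIso (fiber (fun w : N => from (projT1 w)) m) (hfiber g (to m))
    (fun u => eq_rect _ (fun l => El (hfiber g l)) (projT2 (proj1_sig u)) _ (k _ (proj2_sig u)))
    (fun h => exist _ (existT (fun l => El (hfiber g l)) (to m) h : N) (ft m)) _ _).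
  + intros [[l h] e]. apply sig_eq_UIP.
    assert (q : forall l' (e' : l = l'),
      existT (fun l => El (hfiber g l)) l' (eq_rect l (fun l => El (hfiber g l)) h l' e')
      = existT _ l h) by (intros l' e'; destruct e'; reflexivity).
    apply q.
  + intro h.
    assert (q : forall e' : to m = to m,
      eq_rect (to m) (fun l => El (hfiber g l)) h (to m) e' = h)
      by (intro e'; rewrite (UIP_refl _ _ e'); reflexivity).
    apply q.
Defined.

(** * Limits and matching maps under natural isomorphism *)

Definition Lim_map (T : TwoLevel) (D : Category) (Z W : Diagram T D)
  (t : NatTrans Z W) (s : Lim (compF (FibIncl T) Z)) : Lim (compF (FibIncl T) W).
Proof.
exists (fun d => t d (proj1_sig s d)). intros d e f. simpl.
rewrite <- (naturality_app t). f_equal. exact (proj2_sig s d e f).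
Defined.

Definition Lim_map_iso (T : TwoLevel) (D : Category) (Z W : Diagram T D)
  (t : NatTrans Z W) (i : forall d, isIso (t d)) : isIso (Lim_map t).
Proof.
assert (w : forall s : Lim (compF (FibIncl T) W),
  isCompatible (F := compF (FibIncl T) Z)
    (fun d => proj1_sig (i d) (proj1_sig s d))).
{ intros s d e f. simpl. apply (isIso_inj (i e)).
  rewrite (naturality_app t), (proj2 (proj2_sig (i e))), (proj2 (proj2_sig (i d))).
  exact (proj2_sig s d e f). }
exists (fun s => exist _ _ (w s)). split; intro s; apply Lim_eq; intro d; simpl.
- apply (proj2_sig (i d)).
- apply (proj2_sig (i d)).
Defined.

Definition NatTrans_inv (T : TwoLevel) (D : Category) (Z W : Diagram T D)
  (t : NatTrans Z W) (i : forall d, isIso (t d)) : NatTrans W Z.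
Proof.
refine (@MkNatTrans D (FibTypes T) W Z (fun d => proj1_sig (i d)) _).
intros d e f. extensionality a. apply (isIso_inj (i e)).
refine (eq_trans (proj2 (proj2_sig (i e)) _) _).
refine (eq_trans _ (eq_sym (naturality_app t f (proj1_sig (i d) a)))).
rewrite (proj2 (proj2_sig (i d))). reflexivity.
Defined.

Definition NatTrans_inv_iso (T : TwoLevel) (D : Category) (Z W : Diagram T D)
  (t : NatTrans Z W) (i : forall d, isIso (t d)) (d : D) :
  isIso (NatTrans_inv i d) := isIso_sym (i d).

Definition whisker_forget (T : TwoLevel) (C : Category) (X Y : Diagram T C)
  (t : NatTrans X Y) (z : C) : NatTrans (compF X (forget z)) (compF Y (forget z)) :=
  @MkNatTrans _ (FibTypes T) (compF X (forget z)) (compF Y (forget z))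
    (fun u => t (forget z u)) (fun u v f => naturality t (fmap (forget z) f)).

(** The isomorphism is asked for only at [z] and over its reduced coslice, because the diagrams to
    be compared agree only up to a certain rank. *)
Definition isFibration_matching_iso (T : TwoLevel) (C : Category)
  (X Y : Diagram T C) (z : C) (a : Y z -> X z) (ia : isIso a)
  (t : NatTrans (compF Y (forget z)) (compF X (forget z)))
  (it : forall u, isIso (t u))
  (sq : forall (u : RedCoslice z) (e : Y z),
     t u (fmap Y (projT2 (proj1_sig u)) e) = fmap X (projT2 (proj1_sig u)) (a e)) :
  isFibration T (@matchingMap T C X z) -> isFibration T (@matchingMap T C Y z).
Proof.
apply (isFibration_square (a := a) (b := Lim_map t)).
- intro e. apply Lim_eq. intro u. apply sq.
- exact ia.
- apply Lim_map_iso. exact it.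
Defined.

(** * Matching objects over reduced coslices *)

Section Rank.

Variables (T : TwoLevel) (C : Category) (rank : C -> nat).
Hypothesis rank_hom : forall x y : C, Hom x y -> rank y <= rank x.
Hypothesis rank_id : forall (x y : C) (f : Hom x y), rank x = rank y ->
  exists p : x = y, eq_rect x (fun w => Hom w y) f y p = idm y.

(** The analogue of path induction for rank-preserving morphisms: with target and arrow both free,
    creation of identities needs no transport. *)
Lemma rank_id_ind (x : C) (P : forall y, Hom x y -> Prop) : P x (idm x) ->
  forall (y : C) (f : Hom x y), rank x = rank y -> P y f.
Proof.
intros H y f e. destruct (rank_id f e) as [p q]. destruct p.
simpl in q. subst f. exact H.
Qed.

Lemma rank_eq (x y : C) (f : Hom x y) : rank x = rank y -> x = y.
Proof. intro e. destruct (rank_id f e) as [p _]. exact p. Qed.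

Lemma rank_red (x : C) (u : RedCoslice x) : rank (projT1 (proj1_sig u)) < rank x.
Proof.
destruct u as [[y f] h]. simpl.
assert (l := rank_hom f). assert (rank x <> rank y); [|lia].
intro e. apply h. revert y f e l h.
refine (@rank_id_ind x (fun y f => _ -> _ -> existT _ y f = existT _ x (idm x)) _).
reflexivity.
Qed.

Definition red (x y : C) (f : Hom x y) (h : rank x <> rank y) : RedCoslice x.
Proof.
exists (existT _ y f). intro e. apply h.
exact (f_equal rank (eq_sym (f_equal (@projT1 _ _) e))).
Defined.

Definition red_hom (x y z : C) (f : Hom x y) (g : Hom y z)
  (h : rank x <> rank y) (k : rank x <> rank z) :
  Hom (red f h) (red (comp g f) k) :=
  exist (fun l : Hom y z => comp l f = comp g f) g eq_refl.

(** The two indices differ only in their proofs of not being an identity; compatibility along the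
    morphism over [idm] replaces an equality of objects. *)
Lemma matching_red (X : Diagram T C) (x : C) (s : Matching X x)
  (u : RedCoslice x) (h : rank x <> rank (projT1 (proj1_sig u))) :
  proj1_sig s (red (projT2 (proj1_sig u)) h) = proj1_sig s u.
Proof.
refine (eq_trans (eq_sym _) (proj2_sig s (red (projT2 (proj1_sig u)) h) u
  (exist _ (idm _) (comp_idl _)))).
exact (@fmap_id_app T C X (projT1 (proj1_sig u)) _).
Qed.

Section CosliceReedy.

Variables (X : Diagram T C) (x : C) (u : RedCoslice x).

Let y : C := projT1 (proj1_sig u).
Let f : Hom x y := projT2 (proj1_sig u).

(** An arrow [g] out of [y] becomes the triangle from [f] to the composite of [g] with [f]; it is
    not an identity because the rank drops. *)
Definition into_iterated (v : RedCoslice y) : RedCoslice u.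
Proof.
assert (h : rank x <> rank (projT1 (proj1_sig v))).
{ assert (a := rank_red u). assert (b := rank_red v). fold y in a. lia. }
exists (existT (fun w => Hom u w) (red (comp (projT2 (proj1_sig v)) f) h)
  (exist (fun l : Hom y (projT1 (proj1_sig v)) => comp l f = comp (projT2 (proj1_sig v)) f)
     (projT2 (proj1_sig v)) eq_refl)).
intro e. assert (b := rank_red v).
assert (c : rank (projT1 (proj1_sig v)) = rank y)
  by exact (f_equal (fun q => rank (projT1 (proj1_sig (projT1 q)))) e).
lia.
Defined.

Definition into_iterated_hom (v v' : RedCoslice y) (k : Hom v v') :
  Hom (into_iterated v) (into_iterated v').
Proof.
unshelve eexists.
- exists (proj1_sig k). simpl. rewrite comp_assoc. f_equal. exact (proj2_sig k).
- apply sig_eq_UIP. exact (proj2_sig k).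
Defined.

(* A morphism of [x // C] preserving the rank is an identity; stated in the
   total space so that its target may vary. *)
Lemma coslice_id_of_rank (w : RedCoslice x) (k : Hom u w) :
  rank y = rank (projT1 (proj1_sig w)) ->
  existT (fun w => Hom u w) w k = existT (fun w => Hom u w) u (idm u).
Proof.
destruct w as [[w h] p], k as [g q]. intro e. simpl in h, g, q, e.
revert w g e h p q.
refine (@rank_id_ind y (fun w g => forall (h : Hom x w)
  (p : existT (fun y => Hom x y) w h <> existT _ x (idm x)) (q : comp g f = h),
  @existT (RedCoslice x) (@Hom (RedCoslice x) u) (exist _ (existT _ w h) p)
    (exist _ g q)
  = @existT (RedCoslice x) (@Hom (RedCoslice x) u) u (idm u)) _).
subst f y. destruct u as [[y f] r]. simpl. intros h p q.
assert (e : f = h) by (rewrite <- q, comp_idl; reflexivity).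
revert p q. destruct e. intros p q.
assert (e : r = p) by apply neq_irrelevance. destruct e. f_equal.
apply sig_eq_UIP. reflexivity.
Qed.

Definition from_iterated (v : RedCoslice u) : RedCoslice y.
Proof.
exists (existT (fun w => Hom y w) (projT1 (proj1_sig (projT1 (proj1_sig v))))
  (proj1_sig (projT2 (proj1_sig v)))).
(* If the underlying arrow were the identity of [y], the rank would be preserved and the triangle
   would itself be an identity. *)
intro e. destruct v as [[w k] q]. apply q. apply coslice_id_of_rank.
exact (f_equal (fun q => rank (projT1 q)) (eq_sym e)).
Defined.

Definition from_iterated_hom (v v' : RedCoslice u) (k : Hom v v') :
  Hom (from_iterated v) (from_iterated v') :=
  exist _ (proj1_sig (proj1_sig k)) (f_equal (@proj1_sig _ _) (proj2_sig k)).

Definition iterated_matching (s : Matching (compF X (forget x)) u) : Matching X y :=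
  exist (@isCompatible _ (compF (FibIncl T) (compF X (forget y))))
    (fun v => proj1_sig s (into_iterated v))
    (fun v v' k => proj2_sig s _ _ (into_iterated_hom k)).

(* The round trips fix objects only up to equality, but the canonical morphism
   between [v] and its round trip lies over an identity of [C], so compatibility
   of the family replaces transport. *)
Definition iterated_matching_iso : isIso iterated_matching.
Proof.
exists (fun s : Matching X y => exist (@isCompatible _ (compF (FibIncl T)
    (compF (compF X (forget x)) (forget u))))
  (fun v => proj1_sig s (from_iterated v))
  (fun v v' k => proj2_sig s _ _ (from_iterated_hom k))).
split.
- intro s. apply Lim_eq. intro v.
  unshelve epose proof (proj2_sig s (into_iterated (from_iterated v)) v _) as e.
  + unshelve eexists.
    * exists (idm _). simpl. rewrite comp_idl. exact (proj2_sig (projT2 (proj1_sig v))).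
    * apply sig_eq_UIP. apply comp_idl.
  + refine (eq_trans _ e). symmetry.
    exact (@fmap_id_app T C X (projT1 (proj1_sig (projT1 (proj1_sig v)))) _).
- intro s. apply Lim_eq. intro v.
  unshelve epose proof (proj2_sig s (from_iterated (into_iterated v)) v _) as e.
  + exists (idm _). apply comp_idl.
  + refine (eq_trans _ e). symmetry.
    exact (@fmap_id_app T C X (projT1 (proj1_sig v)) _).
Defined.

(** Passing to a reduced coslice leaves the matching map unchanged up to isomorphism, so Reedy
    fibrancy at [y] is inherited by the restricted diagram. *)
Definition iterated_coslice_fibration :
  isFibration T (@matchingMap T C X y) ->
  isFibration T (@matchingMap T _ (compF X (forget x)) u).
Proof.
apply (isFibration_square (a := fun e => e) (b := iterated_matching)).
- intro e. apply Lim_eq. intro v. reflexivity.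
- apply isIso_id.
- apply iterated_matching_iso.
Defined.

End CosliceReedy.

(** * Replacing the objects of a given rank *)

Section Step.

Variables (Y : Diagram T C) (n : nat).
Variable fct : forall z : C, rank z = n -> Factorization (@matchingMap T C Y z).

(* The decision is kept as an argument, so that the functor laws are proved by
   case analysis without dependent rewriting. *)
Definition step_ob (z : C) (d : {rank z = n} + {rank z <> n}) : U T :=
  match d with left e => mid (fct e) | right _ => Y z end.

(** The action of a morphism between two objects of rank [n]: the morphism is an identity, but only
    along an equality of objects. *)
Definition mid_cast (x y : C) (p : x = y) (ex : rank x = n) (ey : rank y = n)
  (a : mid (fct ex)) : mid (fct ey).
Proof. destruct p. rewrite (UIP_nat _ _ ey ex). exact a. Defined.

Lemma mid_cast_refl (x : C) (p : x = x) (e : rank x = n) (a : mid (fct e)) :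
  mid_cast p e a = a.
Proof.
rewrite (UIP_refl _ _ p). unfold mid_cast.
rewrite (UIP_refl _ _ (UIP_nat _ _ e e)). reflexivity.
Qed.

Lemma rank_neq (x y : C) (ex : rank x = n) (ny : rank y <> n) : rank x <> rank y.
Proof. congruence. Qed.

(** A point of a replaced object acts through the components of its image in the matching object; a
    map into a replaced object is the old action followed by [mid_in]. *)
Definition step_map (x y : C) (f : Hom x y) (dx : {rank x = n} + {rank x <> n})
  (dy : {rank y = n} + {rank y <> n}) : step_ob dx -> step_ob dy :=
  match dx, dy return step_ob dx -> step_ob dy with
  | left ex, left ey => mid_cast (rank_eq f (eq_trans ex (eq_sym ey))) ey
  | left ex, right ny => fun a =>
      proj1_sig (mid_out a) (red f (rank_neq ex ny))
  | right _, left ey => fun a => mid_in (fct ey) (fmap Y f a)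
  | right _, right _ => fun a => fmap Y f a
  end.

Arguments step_map [x y] f dx dy _.

Definition step_in (z : C) (d : {rank z = n} + {rank z <> n}) : Y z -> step_ob d :=
  match d return Y z -> step_ob d with
  | left e => mid_in (fct e)
  | right _ => fun a => a
  end.

Lemma mid_out_in_at (x : C) (e : rank x = n) (a : Y x) (u : RedCoslice x) :
  proj1_sig (mid_out (mid_in (fct e) a)) u = fmap Y (projT2 (proj1_sig u)) a.
Proof. rewrite mid_out_in. reflexivity. Qed.

Lemma step_map_id (x : C) (d : {rank x = n} + {rank x <> n}) (a : step_ob d) :
  step_map (idm x) d d a = a.
Proof.
destruct d as [e|e]; simpl.
- apply mid_cast_refl.
- exact (@fmap_id_app T C Y x a).
Qed.

(** In the suffixes [n] marks rank [n] and [o] another rank; a [dz] left undecided leaves the last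
    rank open. Here [f] is an identity by rank. *)
Lemma step_map_comp_nn (x y : C) (f : Hom x y) (ex : rank x = n)
  (ey : rank y = n) : forall (z : C) (g : Hom y z)
  (dz : {rank z = n} + {rank z <> n}) (a : step_ob (left ex)),
  step_map (comp g f) (left ex) dz a
  = step_map g (left ey) dz (step_map f (left ex) (left ey) a).
Proof.
assert (E : rank x = rank y) by congruence. revert ey.
refine (@rank_id_ind x (fun y f => forall (ey : rank y = n) (z : C)
  (g : Hom y z) (dz : {rank z = n} + {rank z <> n}) (a : step_ob (left ex)),
  step_map (comp g f) (left ex) dz a
  = step_map g (left ey) dz (step_map f (left ex) (left ey) a)) _ y f E).
intros ey z g dz a. rewrite comp_idr. assert (e : ey = ex) by apply UIP_nat.
rewrite e, step_map_id. reflexivity.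
Qed.

Lemma step_map_comp_onn (x y : C) (f : Hom x y) (nx : rank x <> n)
  (ey : rank y = n) (z : C) (g : Hom y z) (ez : rank z = n) (a : Y x) :
  step_map (comp g f) (right nx) (left ez) a
  = step_map g (left ey) (left ez) (step_map f (right nx) (left ey) a).
Proof.
assert (E : rank y = rank z) by congruence. revert ez.
refine (@rank_id_ind y (fun z g => forall ez : rank z = n,
  step_map (comp g f) (right nx) (left ez) a
  = step_map g (left ey) (left ez) (step_map f (right nx) (left ey) a)) _ z g E).
intro ez. rewrite comp_idl. assert (e : ez = ey) by apply UIP_nat.
rewrite e, step_map_id. reflexivity.
Qed.

(** Passing through a replaced object changes nothing, since [mid_out] after [mid_in] is the old
    matching map. *)
Lemma step_map_comp_ono (x y : C) (f : Hom x y) (nx : rank x <> n)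
  (ey : rank y = n) (z : C) (g : Hom y z) (nz : rank z <> n) (a : Y x) :
  step_map (comp g f) (right nx) (right nz) a
  = step_map g (left ey) (right nz) (step_map f (right nx) (left ey) a).
Proof.
exact (eq_trans (@fmap_comp_app T C Y x y z g f a)
        (eq_sym (mid_out_in_at ey (fmap Y f a) (red g (rank_neq ey nz))))).
Qed.

(** This is the compatibility of the family [mid_out a]. *)
Lemma step_map_comp_noo (x y : C) (f : Hom x y) (ex : rank x = n)
  (ny : rank y <> n) (z : C) (g : Hom y z) (nz : rank z <> n)
  (a : step_ob (left ex)) :
  step_map (comp g f) (left ex) (right nz) a
  = step_map g (right ny) (right nz) (step_map f (left ex) (right ny) a).
Proof.
symmetry.
exact (proj2_sig (mid_out a) _ _ (red_hom f g (rank_neq ex ny) (rank_neq ex nz))).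
Qed.

Lemma step_map_comp_oon (x y : C) (f : Hom x y) (nx : rank x <> n)
  (ny : rank y <> n) (z : C) (g : Hom y z) (dz : {rank z = n} + {rank z <> n})
  (a : Y x) :
  step_map (comp g f) (right nx) dz a
  = step_map g (right ny) dz (step_map f (right nx) (right ny) a).
Proof.
assert (E := @fmap_comp_app T C Y x y z g f a).
destruct dz as [ez|nz]; [exact (f_equal (mid_in (fct ez)) E) | exact E].
Qed.

Lemma step_map_comp (x y z : C) (g : Hom y z) (f : Hom x y)
  (dx : {rank x = n} + {rank x <> n}) (dy : {rank y = n} + {rank y <> n})
  (dz : {rank z = n} + {rank z <> n}) :
  forall a : step_ob dx,
  step_map (comp g f) dx dz a = step_map g dy dz (step_map f dx dy a).
Proof.
destruct dx as [ex|nx], dy as [ey|ny].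
- apply step_map_comp_nn.
- destruct dz as [ez|nz].
  (* Ranks never increase along a morphism, so a path that leaves rank [n] cannot return to it. *)
  + exfalso. assert (b := rank_hom f). assert (c := rank_hom g). lia.
  + apply step_map_comp_noo.
- destruct dz as [ez|nz].
  + exact (step_map_comp_onn f nx ey g ez).
  + exact (step_map_comp_ono f nx ey g nz).
- exact (step_map_comp_oon f nx ny g dz).
Qed.

Lemma step_in_natural (x y : C) (f : Hom x y) (dx : {rank x = n} + {rank x <> n})
  (dy : {rank y = n} + {rank y <> n}) (a : Y x) :
  step_in dy (fmap Y f a) = step_map f dx dy (step_in dx a).
Proof.
destruct dx as [ex|ex], dy as [ey|ey]; try reflexivity.
- assert (E : rank x = rank y) by congruence. revert ey.
  refine (@rank_id_ind x (fun y f => forall ey : rank y = n,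
    step_in (left ey) (fmap Y f a)
    = step_map f (left ex) (left ey) (step_in (left ex) a)) _ y f E).
  intro ey. assert (e : ey = ex) by apply UIP_nat. rewrite e, step_map_id.
  f_equal. exact (@fmap_id_app T C Y x a).
- exact (eq_sym (mid_out_in_at ex a (red f (rank_neq ex ey)))).
Qed.

Let dec (z : C) : {rank z = n} + {rank z <> n} := Nat.eq_dec (rank z) n.

Definition step : Diagram T C.
Proof.
refine (@MkFunctor C (FibTypes T) (fun z => step_ob (dec z))
  (fun x y f => step_map f (dec x) (dec y)) _ _).
- intro x. extensionality a. apply step_map_id.
- intros x y z g f. extensionality a. apply step_map_comp.
Defined.

Definition step_trans : NatTrans Y step.
Proof.
refine (@MkNatTrans C (FibTypes T) Y step (fun z => step_in (dec z)) _).
intros x y f. extensionality a. apply step_in_natural.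
Defined.

Definition step_trans_iso (z : C) : rank z <> n -> isIso (step_trans z).
Proof.
intro ne. unfold step_trans. simpl. destruct (dec z) as [e|e].
- destruct (ne e).
- apply isIso_id.
Defined.

Definition step_trans_equiv (z : C) : rank z = n ->
  @isEquiv T (Y z) (step z) (step_trans z).
Proof.
intro e. unfold step_trans, step. simpl. destruct (dec z) as [e'|ne].
- apply mid_in_equiv.
- destruct (ne e).
Defined.

Definition step_to_mid (z : C) (e : rank z = n)
  (d : {rank z = n} + {rank z <> n}) : step_ob d -> mid (fct e) :=
  match d with
  | left e' => mid_cast eq_refl e
  | right ne => fun _ => False_rect _ (ne e)
  end.

Definition step_to_mid_iso (z : C) (e : rank z = n)
  (d : {rank z = n} + {rank z <> n}) : isIso (step_to_mid e (d := d)).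
Proof.
destruct d as [e'|ne]; [|destruct (ne e)].
exists (mid_cast eq_refl e'). rewrite (UIP_nat _ _ e' e).
split; intro a; unfold step_to_mid; rewrite !mid_cast_refl; reflexivity.
Defined.

(** At rank [n] this identifies the new matching map with [mid_out], up to the isomorphism of
    matching objects induced by [step_in]. *)
Lemma step_map_to_mid (z : C) (e : rank z = n) (u : RedCoslice z)
  (d : {rank z = n} + {rank z <> n})
  (d' : {rank (forget z u) = n} + {rank (forget z u) <> n}) (a : step_ob d) :
  step_map (projT2 (proj1_sig u)) d d' a
  = step_in d' (proj1_sig (mid_out (step_to_mid e a)) u).
Proof.
assert (b : rank (forget z u) < rank z) by exact (rank_red u).
destruct d as [e'|ne]; [|destruct (ne e)].
destruct d' as [e''|ne']; [lia|].
assert (E : e = e') by apply UIP_nat. destruct E.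
unfold step_to_mid. rewrite mid_cast_refl. apply matching_red.
Qed.

Definition step_fibration
  (R : forall z : C, rank z < n -> isFibration T (@matchingMap T C Y z))
  (z : C) (h : rank z < S n) : isFibration T (@matchingMap T C step z).
Proof.
(* Objects under [z] have rank below [rank z], hence below [n], so the step leaves the matching
   object at [z] unchanged up to isomorphism. *)
assert (iu : forall u : RedCoslice z, isIso (whisker_forget step_trans z u)).
{ intro u. apply step_trans_iso. assert (b : rank (forget z u) < rank z) by exact (rank_red u).
  lia. }
destruct (dec z) as [e|ne].
- apply (isFibration_square (p := @mid_out _ _ _ _ (fct e))
    (a := step_to_mid e (d := dec z)) (b := Lim_map (NatTrans_inv iu))).
  + intro w. apply Lim_eq. intro u. apply (isIso_inj (iu u)).
    refine (eq_trans (proj2 (proj2_sig (iu u)) _) _).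
    apply step_map_to_mid.
  + apply step_to_mid_iso.
  + apply Lim_map_iso. apply NatTrans_inv_iso.
  + apply mid_out_fib.
(* Below rank [n] the value at [z] is unchanged as well, and fibrancy carries over from [Y]. *)
- assert (iz := step_trans_iso ne).
  apply (isFibration_matching_iso (X := Y) (isIso_sym iz)
          (t := NatTrans_inv iu)).
  + apply NatTrans_inv_iso.
  + intros u w. apply (isIso_inj (iu u)).
    refine (eq_trans (proj2 (proj2_sig (iu u)) _) _).
    refine (eq_trans _ (eq_sym (@naturality_app T C Y step step_trans _ _
      (projT2 (proj1_sig u)) (proj1_sig iz w)))).
    rewrite (proj2 (proj2_sig iz)). reflexivity.
  + apply R. lia.
Defined.

End Step.

(** * The limit of the stages *)

Section Tower.

Variables (Y : nat -> Diagram T C) (t : forall n, NatTrans (Y n) (Y (S n))).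
Hypothesis t_iso : forall (n : nat) (z : C), rank z <> n -> isIso (t n z).

(* [Y (S (rank z)) z] is the stable value at [z]. *)
Fixpoint stage (n : nat) (z : C) : rank z < n -> Y (S (rank z)) z -> Y n z :=
  match n return rank z < n -> Y (S (rank z)) z -> Y n z with
  | 0 => fun h _ => False_rect _ (Nat.nlt_0_r _ h)
  | S m => fun h a =>
    match Nat.eq_dec (rank z) m with
    | left e => eq_rect (rank z) (fun k => El (Y (S k) z)) a m e
    | right ne => t m z (@stage m z (proj2 (Nat.le_neq _ _) (conj (le_S_n _ _ h) ne)) a)
    end
  end.

Lemma stage_S (n : nat) (z : C) (h : rank z < n) (h' : rank z < S n)
  (a : Y (S (rank z)) z) : stage h' a = t n z (stage h a).
Proof.
simpl. destruct (Nat.eq_dec (rank z) n) as [e|ne]; [exfalso; lia|].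
do 2 f_equal. apply le_unique.
Qed.

Lemma stage_rank (z : C) (h : rank z < S (rank z)) (a : Y (S (rank z)) z) :
  stage h a = a.
Proof.
simpl. destruct (Nat.eq_dec (rank z) (rank z)) as [e|ne]; [|destruct (ne eq_refl)].
rewrite (UIP_refl _ _ e). reflexivity.
Qed.

Definition stage_iso (n : nat) (z : C) (h : rank z < n) : isIso (stage h).
Proof.
revert h. induction n as [|n IH]; intro h; [destruct (Nat.nlt_0_r _ h)|].
simpl. destruct (Nat.eq_dec (rank z) n) as [e|ne].
- destruct e. apply isIso_id.
- apply (isIso_comp (t_iso ne) (IH _)).
Defined.

Lemma rank_target (x y : C) (f : Hom x y) : rank y < S (rank x).
Proof. apply le_n_S. apply rank_hom. exact f. Qed.

(** At stage [S (rank x)] both [x] and [y] are already stable: act there, then return to the stable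
    value at [y]. *)
Definition tower_map (x y : C) (f : Hom x y) (a : Y (S (rank x)) x) :
  Y (S (rank y)) y :=
  proj1_sig (stage_iso (rank_target f)) (fmap (Y (S (rank x))) f a).

(** Naturality of [stage] wherever it is defined. At [n = S (rank x)] it is the construction of
    [tower_map]; later stages follow by naturality of [t]. *)
Lemma stage_tower_map (n : nat) (x y : C) (f : Hom x y) (hx : rank x < n)
  (hy : rank y < n) (a : Y (S (rank x)) x) :
  stage hy (tower_map f a) = fmap (Y n) f (stage hx a).
Proof.
revert hx hy. induction n as [|n IH]; intros hx hy; [destruct (Nat.nlt_0_r _ hx)|].
destruct (Nat.eq_dec (rank x) n) as [e|ne].
- subst n. rewrite stage_rank, (le_unique _ _ hy (rank_target f)).
  apply (proj2_sig (stage_iso (rank_target f))).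
- assert (kx : rank x < n) by lia.
  assert (ky : rank y < n) by (assert (b := rank_hom f); lia).
  rewrite (stage_S ky), (stage_S kx), (IH kx ky).
  exact (@naturality_app T C _ _ (t n) x y f (stage kx a)).
Qed.

Definition tower_limit : Diagram T C.
Proof.
refine (@MkFunctor C (FibTypes T) (fun z => Y (S (rank z)) z) tower_map _ _).
- intro x. extensionality a. apply (isIso_inj (stage_iso (rank_target (idm x)))).
  rewrite (stage_tower_map (idm x) (rank_target (idm x))).
  exact (@fmap_id_app T C (Y (S (rank x))) x _).
- intros x y z g f. extensionality a.
  assert (hz := rank_target (comp g f)).
  (* The law is checked inside the single diagram [Y (S (rank x))], where it is functoriality. *)
  apply (isIso_inj (stage_iso hz)).
  refine (eq_trans (stage_tower_map (comp g f) (rank_target (idm x)) hz a) _).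
  refine (eq_trans _ (eq_sym (stage_tower_map g (rank_target f) hz (tower_map f a)))).
  rewrite (stage_tower_map f (rank_target (idm x)) (rank_target f)).
  exact (@fmap_comp_app T C (Y (S (rank x))) x y z g f _).
Defined.

Definition tower_limit_Reedy
  (R : forall (n : nat) (z : C), rank z < n -> isFibration T (@matchingMap T C (Y n) z)) :
  ReedyFibrant tower_limit.
Proof.
intro z.
assert (h : forall u : RedCoslice z, rank (forget z u) < S (rank z)).
{ intro u. assert (b : rank (forget z u) < rank z) by exact (rank_red u).
  lia. }
assert (N : forall (u v : RedCoslice z) (f : Hom u v),
  @comp (FibTypes T) _ _ _ (stage (h v)) (fmap (compF tower_limit (forget z)) f)
  = @comp (FibTypes T) _ _ _ (fmap (compF (Y (S (rank z))) (forget z)) f)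
      (stage (h u))).
{ intros u v f. extensionality a. apply (@stage_tower_map _ _ _ _ (h u) (h v)). }
(* At stage [S (rank z)] both [z] and its whole reduced coslice are stable. *)
refine (isFibration_matching_iso (X := Y (S (rank z))) (Y := tower_limit)
  (stage_iso (le_n (S (rank z))))
  (t := @MkNatTrans _ (FibTypes T) (compF tower_limit (forget z))
     (compF (Y (S (rank z))) (forget z)) (fun u => stage (h u)) N) _ _ _).
- intro u. apply stage_iso.
- intros u e. apply (@stage_tower_map _ _ _ (projT2 (proj1_sig u))).
- apply R. apply le_n.
Defined.

Fixpoint tower_trans (n : nat) (z : C) : Y 0 z -> Y n z :=
  match n with
  | 0 => fun a => a
  | S m => fun a => t m z (tower_trans m a)
  end.

Lemma tower_trans_natural (n : nat) (x y : C) (f : Hom x y) (a : Y 0 x) :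
  tower_trans n (fmap (Y 0) f a) = fmap (Y n) f (tower_trans n a).
Proof.
induction n as [|n IH]; [reflexivity|]. simpl. rewrite IH.
exact (@naturality_app T C _ _ (t n) x y f _).
Qed.

Definition tower_trans_iso (n : nat) (z : C) (h : n <= rank z) :
  isIso (tower_trans n (z := z)).
Proof.
induction n as [|n IH]; [apply isIso_id|]. simpl.
assert (ne : rank z <> n) by lia.
exact (isIso_comp (t_iso ne) (IH (Nat.le_trans _ _ _ (le_S _ _ (le_n n)) h))).
Defined.

Lemma stage_tower_trans (n : nat) (z : C) (h : rank z < n) (a : Y 0 z) :
  stage h (tower_trans (S (rank z)) a) = tower_trans n a.
Proof.
induction n as [|n IH]; [destruct (Nat.nlt_0_r _ h)|].
destruct (Nat.eq_dec (rank z) n) as [e|ne].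
- subst n. apply stage_rank.
- assert (k : rank z < n) by lia. rewrite (stage_S k), IH. reflexivity.
Qed.

Definition tower_limit_trans : NatTrans (Y 0) tower_limit.
Proof.
refine (@MkNatTrans C (FibTypes T) (Y 0) tower_limit
  (fun z => tower_trans (S (rank z)) (z := z)) _).
intros x y f. extensionality a.
apply (isIso_inj (stage_iso (rank_target f))).
refine (eq_trans (stage_tower_trans _ _) _).
refine (eq_trans _ (eq_sym (stage_tower_map f (rank_target (idm x)) _ _))).
rewrite stage_tower_trans. apply tower_trans_natural.
Defined.

(** The steps before [rank z] are isomorphisms at [z], so a single genuine replacement, at step
    [rank z], has to be an equivalence. *)
Definition tower_limit_trans_equiv
  (E : forall z : C, @isEquiv T (Y (rank z) z) (Y (S (rank z)) z) (t (rank z) z)) :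
  isDiagramEquiv tower_limit_trans :=
  fun z => isEquiv_precomp_iso (tower_trans_iso (le_n (rank z))) (E z).

End Tower.

(** * Iterating the replacement from the given diagram *)

Section Replacement.

Variables (admC : Admissible T C) (X : Diagram T C).

Definition ReedyBelow (n : nat) : Type :=
  {Y : Diagram T C &
    forall z : C, rank z < n -> isFibration T (@matchingMap T C Y z)}.

Definition matching_factorization (n : nat) (Y : ReedyBelow n) (z : C)
  (e : rank z = n) : Factorization (@matchingMap T C (projT1 Y) z).
Proof.
(* All objects of the reduced coslice have rank below [n]. The limit of this restriction is by
   definition the matching object at [z]. *)
assert (R : ReedyFibrant (compF (projT1 Y) (forget z))).
{ intro u. apply iterated_coslice_fibration. apply (projT2 Y).
  rewrite <- e. apply rank_red. }
exact (factorize (projT2 (admC R)) _).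
Defined.

Fixpoint replacement_stage (n : nat) : ReedyBelow n :=
  match n with
  | 0 => existT _ X (fun z h => False_rect _ (Nat.nlt_0_r _ h))
  | S m => existT _ (step (matching_factorization (replacement_stage m)))
             (step_fibration (matching_factorization (replacement_stage m))
                (projT2 (replacement_stage m)))
  end.

Definition Reedy_replacement : {Y : Diagram T C &
  (ReedyFibrant Y * {eta : NatTrans X Y & isDiagramEquiv eta})%type}.
Proof.
set (Y := fun n => projT1 (replacement_stage n)).
set (t := (fun n => step_trans (matching_factorization (replacement_stage n)))
  : forall n, NatTrans (Y n) (Y (S n))).
assert (ti : forall n z, rank z <> n -> isIso (t n z))
  by (intros n z; apply step_trans_iso).
exists (tower_limit ti). split.
- apply tower_limit_Reedy. intros n. exact (projT2 (replacement_stage n)).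
- exists (tower_limit_trans ti). apply tower_limit_trans_equiv.
  intro z. apply step_trans_equiv. reflexivity.
Defined.

End Replacement.
End Rank.

Theorem mainTheorem5 (T : TwoLevel) (C : Category)
  (invC : InverseCategory C) (admC : Admissible T C) (X : Diagram T C) :
  {Y : Diagram T C &
    (ReedyFibrant Y * {eta : NatTrans X Y & isDiagramEquiv eta})%type}.
Proof.
destruct invC as [phi phiP].
(* A morphism of [NatOp] is an inequality, so [fmap phi] bounds the ranks, and [phiP] is the
   creation of identities. *)
exact (@Reedy_replacement T C phi (fun x y f => fmap phi f) phiP admC X).
Qed.
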